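(* Let $G$ be a compactly generated locally compact group. (1) If $\mathcal{F}$ is a filtering family of closed normal subgroups of $G$, then there exist $N\in\mathcal{F}$ and a closed normal subgroup $K$ of $G$ such that $\bigcap\mathcal{F}\le K\le N$, $K/\bigcap\mathcal{F}$ is compact, and $N/K$ is discrete. (2) If $\mathcal{D}$ is a directed family of closed normal subgroups of $G$, then there exist $N\in\mathcal{D}$ and a closed normal subgroup $K$ of $G$ such that $N\le K\le\overline{\langle\bigcup\mathcal{D}\rangle}$, $K/N$ is compact, and $\overline{\langle\bigcup\mathcal{D}\rangle}/K$ is discrete.
   Context: A family $\mathcal{F}$ of closed normal subgroups is filtering if for all $N,M\in\mathcal{F}$ there is $L\in\mathcal{F}$ with $L\le N\cap M$; a family $\mathcal{D}$ is directed if for all $N,M\in\mathcal{D}$ there is $L\in\mathcal{D}$ with $N\cup M\subseteq L$. $\overline{\langle\bigcup\mathcal{D}\rangle}$ denotes the closed subgroup generated by the union of the members of $\mathcal{D}$. All groups are Hausdorff. *)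

(* Defs.v *)
From Stdlib Require Import List.
Set Implicit Arguments.

Record TopGroup := {
  carrier :> Type;
  mul : carrier -> carrier -> carrier;
  inv : carrier -> carrier;
  one : carrier;
  mulA : forall x y z, mul x (mul y z) = mul (mul x y) z;
  mul1g : forall x, mul one x = x;
  mulVg : forall x, mul (inv x) x = one;
  is_open : (carrier -> Prop) -> Prop;
  open_full : is_open (fun _ => True);
  open_inter : forall U V, is_open U -> is_open V ->
      is_open (fun x => U x /\ V x);
  open_union : forall F : (carrier -> Prop) -> Prop,
      (forall U, F U -> is_open U) -> is_open (fun x => exists U, F U /\ U x);
  mul_cont : forall W x y, is_open W -> W (mul x y) ->
      exists U V, is_open U /\ is_open V /\ U x /\ V y /\
        (forall a b, U a -> V b -> W (mul a b));
  inv_cont : forall W, is_open W -> is_open (fun x => W (inv x))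
}.

Section Defs.
Variable G : TopGroup.

Definition subset (A B : G -> Prop) : Prop := forall x, A x -> B x.

Definition is_closed (A : G -> Prop) : Prop := is_open G (fun x => ~ A x).

Definition hausdorff : Prop :=
  forall x y : G, x <> y -> exists U V, is_open G U /\ is_open G V /\
    U x /\ V y /\ (forall z, U z -> V z -> False).

Definition compact (K : G -> Prop) : Prop :=
  forall F : (G -> Prop) -> Prop,
    (forall U, F U -> is_open G U) ->
    (forall x, K x -> exists U, F U /\ U x) ->
    exists l : list (G -> Prop), (forall U, In U l -> F U) /\
      (forall x, K x -> exists U, In U l /\ U x).

Definition locally_compact : Prop :=
  forall x : G, exists U K, is_open G U /\ U x /\ compact K /\ subset U K.

Definition subgroup (H : G -> Prop) : Prop :=
  H (one G) /\ (forall x y, H x -> H y -> H (mul G x y)) /\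
  (forall x, H x -> H (inv G x)).

Definition normal_subgroup (H : G -> Prop) : Prop :=
  subgroup H /\ forall g x, H x -> H (mul G g (mul G x (inv G g))).

Definition closed_normal_subgroup (H : G -> Prop) : Prop :=
  normal_subgroup H /\ is_closed H.

Definition gen (S : G -> Prop) : G -> Prop :=
  fun x => forall H, subgroup H -> subset S H -> H x.

Definition closed_gen (S : G -> Prop) : G -> Prop :=
  fun x => forall H, subgroup H -> is_closed H -> subset S H -> H x.

Definition compactly_generated : Prop :=
  exists K, compact K /\ forall x : G, gen K x.

(* Quotient A/B of subgroups B <= A (B normal in G), with A carrying the
   subspace topology and A/B the quotient topology.  Open subsets of A/B
   correspond exactly to their preimages in A, i.e. to the B-saturated
   subsets of A that are relatively open in A. *)
Definition saturated_in (A B V : G -> Prop) : Prop :=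
  subset V A /\ forall x b, V x -> B b -> V (mul G x b).

Definition rel_open_in (A V : G -> Prop) : Prop :=
  subset V A /\ exists W, is_open G W /\ forall x, A x -> (V x <-> W x).

Definition quotient_open (A B V : G -> Prop) : Prop :=
  saturated_in A B V /\ rel_open_in A V.

Definition quotient_compact (A B : G -> Prop) : Prop :=
  forall F : (G -> Prop) -> Prop,
    (forall V, F V -> quotient_open A B V) ->
    (forall x, A x -> exists V, F V /\ V x) ->
    exists l : list (G -> Prop), (forall V, In V l -> F V) /\
      (forall x, A x -> exists V, In V l /\ V x).

Definition quotient_discrete (A B : G -> Prop) : Prop :=
  forall V, saturated_in A B V -> rel_open_in A V.

Definition filtering (F : (G -> Prop) -> Prop) : Prop :=
  forall N M, F N -> F M -> exists L, F L /\ subset L N /\ subset L M.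

Definition directed (D : (G -> Prop) -> Prop) : Prop :=
  forall N M, D N -> D M -> exists L, D L /\ subset N L /\ subset M L.

Definition big_cap (F : (G -> Prop) -> Prop) : G -> Prop :=
  fun x => forall N, F N -> N x.

Definition big_cup (F : (G -> Prop) -> Prop) : G -> Prop :=
  fun x => exists N, F N /\ N x.

End Defs.

Arguments subset {G}. Arguments is_closed {G}. Arguments compact {G}.
Arguments subgroup {G}. Arguments normal_subgroup {G}.
Arguments closed_normal_subgroup {G}. Arguments gen {G}.
Arguments closed_gen {G}. Arguments saturated_in {G}.
Arguments rel_open_in {G}. Arguments quotient_open {G}.
Arguments quotient_compact {G}. Arguments quotient_discrete {G}.
Arguments filtering {G}. Arguments directed {G}.
Arguments big_cap {G}. Arguments big_cup {G}.

(* Main.v *)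
Require Import Defs.
From Stdlib Require Import List Classical.
From Stdlib Require Import FunctionalExtensionality PropExtensionality.

Set Implicit Arguments.

(** Let [S] be a compact generating set and [C] a compact neighbourhood of [1],
    and choose a neighbourhood [O] of [1] such that [C] contains [O], its
    inverse, [O O], and the conjugates of [O] by elements of [S] and their
    inverses.  If [B <= A] are closed normal subgroups with [A ∩ C] contained in
    [O B], then [(A ∩ C) B = (A ∩ O) B] is a subgroup, is normalized by [S] and
    hence normal in [G], is open in [A], and is compact modulo [B].  Compactness
    of [C] provides such pairs: in (1) with [B] the intersection of the family
    and [A] a small enough member, in (2) with [A] the closure of the union and
    [B] a large enough member. *)

(** * Group identities from the left-sided axioms *)

Lemma mulgV (G : TopGroup) (x : G) : mul G x (inv G x) = one G.
Proof.
  rewrite <- (mul1g G (mul G x (inv G x))), <- (mulVg G (inv G x)) at 1.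
  rewrite <- mulA, (mulA G (inv G x) x), mulVg, mul1g. apply mulVg.
Qed.

Lemma mulg1 (G : TopGroup) (x : G) : mul G x (one G) = x.
Proof. rewrite <- (mulVg G x), mulA, mulgV. apply mul1g. Qed.

Lemma mulgK (G : TopGroup) (x y : G) : mul G (mul G x y) (inv G y) = x.
Proof. rewrite <- mulA, mulgV. apply mulg1. Qed.

Lemma mulgVK (G : TopGroup) (x y : G) : mul G (mul G x (inv G y)) y = x.
Proof. rewrite <- mulA, mulVg. apply mulg1. Qed.

Lemma invK (G : TopGroup) (x : G) : inv G (inv G x) = x.
Proof.
  rewrite <- (mulg1 G (inv G (inv G x))), <- (mulVg G x), mulA, mulVg.
  apply mul1g.
Qed.

Lemma invM (G : TopGroup) (x y : G) :
  inv G (mul G x y) = mul G (inv G y) (inv G x).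
Proof.
  rewrite <- (mul1g G (mul G (inv G y) (inv G x))), <- (mulVg G (mul G x y)).
  rewrite (mulA G _ (inv G y)), <- (mulA G _ (mul G x y)), !mulgK.
  reflexivity.
Qed.

Lemma inv1 (G : TopGroup) : inv G (one G) = one G.
Proof. rewrite <- (mulg1 G (inv G (one G))). apply mulVg. Qed.

Ltac gsimp := repeat progress rewrite ?mulA, ?invM, ?invK, ?inv1, ?mul1g,
  ?mulg1, ?mulVg, ?mulgV, ?mulgK, ?mulgVK.
Ltac geq := gsimp; reflexivity.

(** * Open sets, compactness and closed generated subgroups *)

Section Topology.
Variable G : TopGroup.

Lemma open_of_local (A : G -> Prop) :
  (forall x, A x -> exists U, is_open G U /\ U x /\ subset U A) -> is_open G A.
Proof.
  intros H.
  replace A with (fun x => exists U, (is_open G U /\ subset U A) /\ U x).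
  { apply open_union. intros U [HU _]. exact HU. }
  apply functional_extensionality. intros x. apply propositional_extensionality.
  split.
  - intros (U & [_ HU] & Ux). auto.
  - intros Ax. destruct (H x Ax) as (U & oU & Ux & HU). eauto.
Qed.

Lemma open_mull (g : G) (O : G -> Prop) :
  is_open G O -> is_open G (fun y => O (mul G g y)).
Proof.
  intros oO. apply open_of_local. intros y Oy.
  destruct (mul_cont G _ g y oO Oy) as (U & V & _ & oV & Ug & Vy & H).
  exists V. repeat split; auto. intros z Vz. auto.
Qed.

Lemma open_mulr (g : G) (O : G -> Prop) :
  is_open G O -> is_open G (fun y => O (mul G y g)).
Proof.
  intros oO. apply open_of_local. intros y Oy.
  destruct (mul_cont G _ y g oO Oy) as (U & V & oU & _ & Uy & Vg & H).
  exists U. repeat split; auto. intros z Uz. auto.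
Qed.

(** Compactness as an induction principle: the open members of the ideal [I] cover [C], and the
    union of a finite subcover is again in [I]. Later uses only have to merge two witnesses and
    treat one point. *)
Lemma compact_ideal (C : G -> Prop) (I : (G -> Prop) -> Prop) :
  compact C ->
  I (fun _ => False) ->
  (forall U V, I U -> I V -> I (fun x => U x \/ V x)) ->
  (forall U V, subset U V -> I V -> I U) ->
  (forall x, C x -> exists U, is_open G U /\ U x /\ I U) ->
  I C.
Proof.
  intros cC I0 IU Imono Iloc.
  destruct (cC (fun U => is_open G U /\ I U)) as (l & Hl & Hcov).
  { intros U [oU _]. exact oU. }
  { intros x Cx. destruct (Iloc x Cx) as (U & oU & Ux & IxU). eauto. }
  apply Imono with (fun x => exists U, In U l /\ U x); [exact Hcov|].
  clear Hcov. induction l as [|U l IHl].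
  - apply (Imono _ (fun _ => False)); [|exact I0]. intros x (U & [] & _).
  - apply Imono with (fun x => U x \/ exists V, In V l /\ V x).
    + intros x (V & [->|HV] & Vx); eauto.
    + apply IU; [apply Hl; now left|].
      apply IHl. intros V HV. apply Hl. now right.
Qed.

(** A tube argument: near each [s], continuity of the triple product [p q r] at [(s, 1, s^-1)] and
    [(s^-1, 1, s)] gives a neighbourhood of [1] that works for all nearby [s]; compactness of [S]
    leaves a finite intersection. *)
Lemma conj_tube (S W : G -> Prop) :
  compact S -> is_open G W -> W (one G) ->
  exists O, is_open G O /\ O (one G) /\
    forall s o, S s -> O o ->
      W (mul G s (mul G o (inv G s))) /\ W (mul G (inv G s) (mul G o s)).
Proof.
  intros cS oW W1.
  apply (compact_ideal (fun U => exists O, is_open G O /\ O (one G) /\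
    forall s o, U s -> O o ->
      W (mul G s (mul G o (inv G s))) /\ W (mul G (inv G s) (mul G o s))) cS).
  - exists (fun _ => True). split; [apply open_full|]. tauto.
  - intros U V (O & oO & O1 & HO) (Q & oQ & Q1 & HQ).
    exists (fun x => O x /\ Q x). repeat split; auto using open_inter;
      destruct H as [H|H], H0 as [H0 H0'];
      first [apply HO; assumption | apply HQ; assumption].
  - intros U V UV (O & oO & O1 & HO). exists O. repeat split; auto;
      apply HO; auto.
  - intros s _.
    assert (conj_local : forall a b : G, mul G a b = one G ->
      exists P R Q, is_open G P /\ is_open G R /\ is_open G Q /\ P a /\ R b /\
        Q (one G) /\ forall p r q, P p -> R r -> Q q -> W (mul G p (mul G q r))).
    { intros a b ab.
      assert (W' : W (mul G a (mul G (one G) b))) by now rewrite mul1g, ab.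
      destruct (mul_cont G _ _ _ oW W') as (P & T & oP & oT & Pa & Tb & H).
      destruct (mul_cont G _ _ _ oT Tb) as (Q & R & oQ & oR & Q1 & Rb & H').
      exists P, R, Q. repeat split; auto. }
    destruct (conj_local s (inv G s) (mulgV G s))
      as (P & R & Q & oP & oR & oQ & Ps & Rs & Q1 & H).
    destruct (conj_local (inv G s) s (mulVg G s))
      as (P' & R' & Q' & oP' & oR' & oQ' & Ps' & Rs' & Q1' & H').
    exists (fun x => (P x /\ R (inv G x)) /\ (P' (inv G x) /\ R' x)).
    split; [|split; [tauto|]].
    { repeat apply open_inter; auto; apply (inv_cont G _); auto. }
    exists (fun x => Q x /\ Q' x). split; [now apply open_inter|].
    split; [tauto|]. intros t o [[? ?] [? ?]] [? ?]. auto.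
Qed.

Lemma closed_gen_closed_subgroup (S : G -> Prop) :
  subgroup (closed_gen S) /\ is_closed (closed_gen S).
Proof.
  repeat split.
  - intros H sH _ _. apply sH.
  - intros x y Hx Hy H sH cH SH. apply sH; [apply Hx|apply Hy]; auto.
  - intros x Hx H sH cH SH. apply sH. apply Hx; auto.
  - apply open_of_local. intros x Hx.
    apply not_all_ex_not in Hx. destruct Hx as [H Hx].
    exists (fun y => ~ H y).
    apply imply_to_and in Hx. destruct Hx as [sH Hx].
    apply imply_to_and in Hx. destruct Hx as [cH Hx].
    apply imply_to_and in Hx. destruct Hx as [SH Hx].
    repeat split; auto. intros y Hy Hy'. apply Hy, Hy'; auto.
Qed.

(** The preimage of a closed subgroup containing [S] under conjugation by [g] is again such a
    subgroup, so it contains [closed_gen S]. *)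
Lemma closed_gen_normal (S : G -> Prop) :
  (forall g x, S x -> S (mul G g (mul G x (inv G g)))) ->
  closed_normal_subgroup (closed_gen S).
Proof.
  intros nS. destruct (closed_gen_closed_subgroup S) as [sL cL].
  split; [split|]; auto. intros g x Lx H sH cH SH.
  apply (Lx (fun y => H (mul G g (mul G y (inv G g))))).
  - destruct sH as (H1 & HM & HV). repeat split.
    + replace (mul G g _) with (one G) by geq. exact H1.
    + intros a b Ha Hb.
      replace (mul G g _) with (mul G (mul G g (mul G a (inv G g)))
        (mul G g (mul G b (inv G g)))) by geq. auto.
    + intros a Ha.
      replace (mul G g _) with (inv G (mul G g (mul G a (inv G g)))) by geq.
      auto.
  - apply (open_mulr (inv G g) (fun y => ~ H (mul G g y))).
    exact (open_mull g _ cH).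
  - intros y Sy. apply SH, nS, Sy.
Qed.

(** The topological closure of the union is already a closed subgroup: directedness puts
    approximants of two factors into one member, which then contains their product. *)
Lemma directed_union_dense (D : (G -> Prop) -> Prop) :
  (forall N, D N -> subgroup N) -> (exists N, D N) -> directed D ->
  forall x U, closed_gen (big_cup D) x -> is_open G U -> U x ->
    exists N n, D N /\ N n /\ U n.
Proof.
  intros sD [N0 DN0] dir x U Lx. revert U.
  apply (Lx (fun x => forall U, is_open G U -> U x ->
    exists N n, D N /\ N n /\ U n)).
  - repeat split.
    + intros U _ U1. exists N0, (one G). repeat split; auto. now apply sD.
    + intros a b Ha Hb W oW Wab.
      destruct (mul_cont G _ _ _ oW Wab) as (U & V & oU & oV & Ua & Vb & H).
      destruct (Ha U oU Ua) as (N & n & DN & Nn & Un).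
      destruct (Hb V oV Vb) as (M & m & DM & Mm & Vm).
      destruct (dir N M DN DM) as (L & DL & NL & ML).
      exists L, (mul G n m). repeat split; auto.
      apply (sD L DL); auto.
    + intros a Ha W oW Wa.
      destruct (Ha _ (inv_cont G _ oW) Wa) as (N & n & DN & Nn & Wn).
      exists N, (inv G n). repeat split; auto. now apply sD.
  - apply open_of_local. intros y Hy.
    apply not_all_ex_not in Hy. destruct Hy as [U Hy].
    apply imply_to_and in Hy. destruct Hy as [oU Hy].
    apply imply_to_and in Hy. destruct Hy as [Uy Hy].
    exists U. repeat split; auto. intros z Uz Hz. apply Hy. auto.
  - intros y (N & DN & Ny) U _ Uy. eauto.
Qed.

Lemma exists_small_neighbourhood (S W : G -> Prop) :
  compact S -> is_open G W -> W (one G) ->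
  exists O, is_open G O /\ O (one G) /\ subset O W /\
    (forall o, O o -> W (inv G o)) /\
    (forall o p, O o -> O p -> W (mul G o p)) /\
    (forall s o, S s -> O o ->
      W (mul G s (mul G o (inv G s))) /\ W (mul G (inv G s) (mul G o s))).
Proof.
  intros cS oW W1.
  destruct (conj_tube _ cS oW W1) as (Q & oQ & Q1 & HQ).
  assert (W1' : W (mul G (one G) (one G))) by now rewrite mul1g.
  destruct (mul_cont G _ _ _ oW W1') as (U & V & oU & oV & U1 & V1 & HUV).
  (* [Q] controls conjugates, [U] and [V] products, and the last two conditions the inclusion and
     inverses. *)
  exists (fun x => (Q x /\ (U x /\ V x)) /\ W x /\ W (inv G x)).
  split.
  { repeat apply open_inter; auto. now apply (inv_cont G W). }
  rewrite inv1.
  split; [tauto|]. split; [intros x; tauto|]. split; [tauto|].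
  split; [intros o p ? ?; apply HUV; tauto|].
  intros s o Ss Oo. apply HQ; tauto.
Qed.

(** * The subgroup [(A ∩ C) B] *)

Section CompactOpen.
Variables S C O A B : G -> Prop.
Hypothesis S_gen : forall x, gen S x.
Hypothesis C_compact : compact C.
Hypothesis O_open : is_open G O.
Hypothesis O1 : O (one G).
Hypothesis O_sub : subset O C.
Hypothesis O_inv : forall o, O o -> C (inv G o).
Hypothesis O_mul : forall o p, O o -> O p -> C (mul G o p).
Hypothesis O_conj : forall s o, S s -> O o ->
  C (mul G s (mul G o (inv G s))) /\ C (mul G (inv G s) (mul G o s)).
Hypothesis A_cn : closed_normal_subgroup A.
Hypothesis B_cn : closed_normal_subgroup B.
Hypothesis BA : subset B A.
Hypothesis AC_small : forall x, A x -> C x ->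
  exists b, B b /\ O (mul G x (inv G b)).

(* [(A ∩ C) B]: as [B <= A], asking [A x] amounts to asking [A (x b^-1)]. *)
Definition trace_product (x : G) : Prop :=
  exists b, B b /\ A x /\ C (mul G x (inv G b)).
Local Notation K := trace_product.

Let A_mul (x y : G) : A x -> A y -> A (mul G x y).
Proof. apply A_cn. Qed.
Let A_inv (x : G) : A x -> A (inv G x).
Proof. apply A_cn. Qed.
Let A_conj (g x : G) : A x -> A (mul G g (mul G x (inv G g))).
Proof. apply A_cn. Qed.
Let B_one : B (one G).
Proof. apply B_cn. Qed.
Let B_mul (x y : G) : B x -> B y -> B (mul G x y).
Proof. apply B_cn. Qed.
Let B_inv (x : G) : B x -> B (inv G x).
Proof. apply B_cn. Qed.
Let B_conj (g x : G) : B x -> B (mul G g (mul G x (inv G g))).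
Proof. apply B_cn. Qed.

Hint Resolve A_mul A_inv A_conj B_one B_mul B_inv B_conj BA : core.

(** The substantial half of [(A ∩ C) B = (A ∩ O) B]. Shrinking the factor in [C] to one in [O]
    leaves room for one product, inversion or conjugation, whose result is back in [C]. *)
Lemma trace_product_small (x : G) :
  K x -> exists b, B b /\ O (mul G x (inv G b)).
Proof.
  intros (b & Bb & Ax & Cx).
  destruct (AC_small (x := mul G x (inv G b))) as (b' & Bb' & Ob'); auto.
  exists (mul G b' b). split; auto.
  replace (mul G x _) with (mul G (mul G x (inv G b)) (inv G b')) by geq.
  exact Ob'.
Qed.

Lemma trace_product_nbhd (x : G) : A x -> O x -> K x.
Proof.
  intros Ax Ox. exists (one G). repeat split; auto.
  rewrite inv1, mulg1. auto.
Qed.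

Lemma trace_product_subgroup : subgroup K.
Proof.
  split; [|split].
  - apply trace_product_nbhd; auto.
  - intros x y Kx Ky.
    assert (Axy : A (mul G x y)).
    { destruct Kx as (? & _ & ? & _), Ky as (? & _ & ? & _). auto. }
    destruct (trace_product_small Kx) as (b & Bb & Ob).
    destruct (trace_product_small Ky) as (d & Bd & Od).
    (* With [o = x b^-1] and [p = y d^-1], one has [x y = o b p d = (o p) (p^-1 b p) d]; the factors
       after [o p] lie in [B] by normality. *)
    exists (mul G (mul G (inv G (mul G y (inv G d)))
      (mul G b (inv G (inv G (mul G y (inv G d)))))) d).
    repeat split; auto.
    replace (mul G (mul G x y) _)
      with (mul G (mul G x (inv G b)) (mul G y (inv G d))) by geq.
    auto.
  - intros x Kx. assert (Ax : A x) by (destruct Kx as (? & _ & ? & _); auto).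
    destruct (trace_product_small Kx) as (b & Bb & Ob).
    (* With [o = x b^-1], one has [x^-1 = b^-1 o^-1 = o^-1 (x b^-1 x^-1)]. *)
    exists (mul G x (mul G (inv G b) (inv G x))). repeat split; auto.
    + replace (mul G (inv G x) _) with (inv G (mul G x (inv G b))) by geq.
      auto.
Qed.

(** Conjugation acts on the two factors separately: the one in [O] moves into [C], the one in [B]
    stays in [B]. The condition on [g] is available for elements of [S] and their inverses. *)
Lemma trace_product_conj (g x : G) :
  (forall o, O o -> C (mul G g (mul G o (inv G g)))) ->
  K x -> K (mul G g (mul G x (inv G g))).
Proof.
  intros Hg Kx. assert (Ax : A x) by (destruct Kx as (? & _ & ? & _); auto).
  destruct (trace_product_small Kx) as (b & Bb & Ob).
  exists (mul G g (mul G b (inv G g))). repeat split; auto.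
  replace (mul G (mul G g _) _)
    with (mul G g (mul G (mul G x (inv G b)) (inv G g))) by geq.
  auto.
Qed.

Lemma trace_product_normal : normal_subgroup K.
Proof.
  split; [exact trace_product_subgroup|]. intros g.
  (* Conjugating [K] into itself is not inherited by inverses, so the subgroup containing [S] is
     formed by those [g] for which both [g] and [g^-1] do so. *)
  apply (S_gen g (H := fun g =>
    (forall x, K x -> K (mul G g (mul G x (inv G g)))) /\
    (forall x, K x -> K (mul G (inv G g) (mul G x g))))).
  - split; [|split].
    + split; intros x Kx; gsimp; exact Kx.
    + intros a b [Ha Ha'] [Hb Hb']. split; intros x Kx.
      * replace (mul G (mul G a b) _) with
          (mul G a (mul G (mul G b (mul G x (inv G b))) (inv G a))) by geq.
        auto.
      * replace (mul G (inv G (mul G a b)) _) with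
          (mul G (inv G b) (mul G (mul G (inv G a) (mul G x a)) b)) by geq.
        auto.
    + intros a [Ha Ha']. rewrite invK. auto.
  - intros s Ss. split; intros x Kx.
    + apply trace_product_conj; auto. intros o Oo. now apply O_conj.
    + rewrite <- (invK G s) at 2. apply trace_product_conj; auto.
      intros o Oo. rewrite invK. now apply O_conj.
Qed.

(** Within [A] this is the closedness of an open subgroup: if the neighbourhood [x O] of [x] in [A]
    met [K] in [y], then [x = y (x^-1 y)^-1] would lie in [K]. Outside [A], the complement of [A] is
    a neighbourhood missing [K]. *)
Lemma trace_product_closed : is_closed K.
Proof.
  apply open_of_local. intros x nKx. destruct (classic (A x)) as [Ax|nAx].
  - exists (fun y => O (mul G (inv G x) y)).
    split; [exact (open_mull (inv G x) _ O_open)|]. split; [now rewrite mulVg|].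
    intros y Oy Ky. apply nKx.
    assert (Ay : A y) by (destruct Ky as (? & _ & ? & _); auto).
    replace x with (mul G y (inv G (mul G (inv G x) y))) by geq.
    apply trace_product_subgroup; [exact Ky|].
    apply trace_product_subgroup, trace_product_nbhd; auto.
  - exists (fun y => ~ A y). split; [apply A_cn|]. split; [exact nAx|].
    intros y nAy (? & _ & Ay & _). auto.
Qed.

(** [A ∩ C] is compact, being closed in [C], and meets every coset of [B] in [K]. A finite family
    covering it covers [K] because its members are [B]-saturated. *)
Lemma trace_product_quotient_compact : quotient_compact K B.
Proof.
  intros F oF covF.
  destruct (compact_ideal (fun U => exists l,
    (forall V, In V l -> F V) /\
    forall x, U x -> A x -> C x -> exists V, In V l /\ V x) C_compact)
    as (l & lF & Hl).
  - exists nil. split; [intros V []|tauto].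
  - intros U U' (l & lF & Hl) (l' & lF' & Hl'). exists (l ++ l'). split.
    + intros V HV. apply in_app_or in HV. destruct HV; auto.
    + intros x [Ux|Ux] Ax Cx;
        [destruct (Hl x Ux Ax Cx) as (V & HV & Vx)
        |destruct (Hl' x Ux Ax Cx) as (V & HV & Vx)];
        exists V; auto using in_or_app.
  - intros U V UV (l & lF & Hl). exists l. auto.
  - intros x Cx. destruct (classic (A x)) as [Ax|nAx].
    + assert (AC_K : forall y, A y -> C y -> K y).
      { intros y Ay Cy. exists (one G). rewrite inv1, mulg1. auto. }
      destruct (covF x (AC_K x Ax Cx)) as (V & FV & Vx).
      destruct (oF V FV) as (_ & _ & W & oW & HW).
      exists W. split; [exact oW|]. split; [now apply HW; auto|].
      exists (V :: nil). split; [intros V' [<-|[]]; auto|].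
      intros y Wy Ay Cy. exists V. split; [now left|]. apply HW; auto.
    + exists (fun y => ~ A y). split; [apply A_cn|]. split; [exact nAx|].
      exists nil. split; [intros V []|tauto].
  - exists l. split; [exact lF|]. intros x (b & Bb & Ax & Cx).
    destruct (Hl (mul G x (inv G b))) as (V & HV & Vx); auto.
    exists V. split; [exact HV|].
    rewrite <- (mulgVK G x b). apply (oF V (lF V HV)); auto.
Qed.

Lemma trace_product_quotient_discrete : quotient_discrete A K.
Proof.
  intros V [VA Vsat]. split; [exact VA|].
  (* This is the open set [V O]; its trace on [A] is [V], since [A ∩ O] lies in [K] and [V] is
     [K]-saturated. *)
  exists (fun w => exists v, V v /\ O (mul G (inv G v) w)). split.
  - apply open_of_local. intros w (v & Vv & Ow).
    exists (fun y => O (mul G (inv G v) y)).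
    split; [exact (open_mull (inv G v) _ O_open)|]. split; [exact Ow|].
    intros y Oy. eauto.
  - intros x Ax. split.
    + intros Vx. exists x. split; [exact Vx|]. now rewrite mulVg.
    + intros (v & Vv & Ov). replace x with (mul G v (mul G (inv G v) x)) by geq.
      apply Vsat; auto. apply trace_product_nbhd; auto.
Qed.

Lemma exists_relatively_compact_open_normal : exists K,
  closed_normal_subgroup K /\ subset B K /\ subset K A /\
  quotient_compact K B /\ quotient_discrete A K.
Proof.
  exists K. split; [exact (conj trace_product_normal trace_product_closed)|].
  split; [|split; [|split]].
  - intros b Bb. exists b. rewrite mulgV. auto.
  - intros x (? & _ & Ax & _). exact Ax.
  - exact trace_product_quotient_compact.
  - exact trace_product_quotient_discrete.
Qed.

End CompactOpen.

(** * Choice of a member in filtering and directed families *)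

Lemma big_cap_closed_normal (F : (G -> Prop) -> Prop) :
  (forall N, F N -> closed_normal_subgroup N) ->
  closed_normal_subgroup (big_cap F).
Proof.
  intros cnF. split; [split; [split; [|split]|]|].
  - intros N FN. now apply cnF.
  - intros x y Hx Hy N FN. apply (cnF N FN); [apply Hx|apply Hy]; exact FN.
  - intros x Hx N FN. apply (cnF N FN), Hx, FN.
  - intros g x Hx N FN. apply (cnF N FN), Hx, FN.
  - apply open_of_local. intros x Hx.
    apply not_all_ex_not in Hx. destruct Hx as [N Hx].
    apply imply_to_and in Hx. destruct Hx as [FN Nx].
    exists (fun y => ~ N y). split; [now apply cnF|]. split; [exact Nx|].
    intros y Ny Hy. exact (Ny (Hy N FN)).
Qed.

(** A point of [C] outside the intersection has a neighbourhood missing some member. Around a point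
    [x] of the intersection, [O x] is handled by [b = x], whatever the member. Filtering merges
    finitely many choices. *)
Lemma filtering_small_member (F : (G -> Prop) -> Prop) (C O : G -> Prop) :
  (forall N, F N -> is_closed N) -> (exists N, F N) -> filtering F ->
  compact C -> is_open G O -> O (one G) ->
  exists N, F N /\ forall x, C x -> N x ->
    exists b, big_cap F b /\ O (mul G x (inv G b)).
Proof.
  intros cF [N0 FN0] filt cC oO O1.
  apply (compact_ideal (fun U => exists N, F N /\ forall x, U x -> N x ->
    exists b, big_cap F b /\ O (mul G x (inv G b))) cC).
  - exists N0. split; [assumption|tauto].
  - intros U V (N & FN & HN) (M & FM & HM).
    destruct (filt N M FN FM) as (L & FL & LN & LM).
    exists L. split; [exact FL|]. intros x [Ux|Vx] Lx; auto.
  - intros U V UV (N & FN & HN). exists N. auto.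
  - intros x _. destruct (classic (big_cap F x)) as [Mx|nMx].
    + exists (fun y => O (mul G y (inv G x))).
      split; [exact (open_mulr (inv G x) _ oO)|]. split; [now rewrite mulgV|].
      exists N0. eauto.
    + apply not_all_ex_not in nMx. destruct nMx as [N nMx].
      apply imply_to_and in nMx. destruct nMx as [FN Nx].
      exists (fun y => ~ N y). split; [now apply cF|]. split; [exact Nx|].
      exists N. split; [exact FN|]. tauto.
Qed.

(** By density, a point [x] of the closure has some [n] in a member with [x] in [O n], and then
    [b = n] serves this whole neighbourhood. Off the closure nothing is asked. Directedness merges
    finitely many choices. *)
Lemma directed_large_member (D : (G -> Prop) -> Prop) (C O : G -> Prop) :
  (forall N, D N -> subgroup N) -> (exists N, D N) -> directed D ->
  compact C -> is_open G O -> O (one G) ->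
  exists N, D N /\ forall x, C x -> closed_gen (big_cup D) x ->
    exists b, N b /\ O (mul G x (inv G b)).
Proof.
  intros sD neD dir cC oO O1.
  apply (compact_ideal (fun U => exists N, D N /\
    forall x, U x -> closed_gen (big_cup D) x ->
    exists b, N b /\ O (mul G x (inv G b))) cC).
  - destruct neD as [N0 DN0]. exists N0. split; [assumption|tauto].
  - intros U V (N & DN & HN) (M & DM & HM).
    destruct (dir N M DN DM) as (L & DL & NL & ML).
    exists L. split; [exact DL|]. intros x [Ux|Vx] Lx.
    + destruct (HN x Ux Lx) as (b & ? & ?). eauto.
    + destruct (HM x Vx Lx) as (b & ? & ?). eauto.
  - intros U V UV (N & DN & HN). exists N. auto.
  - intros x _. destruct (classic (closed_gen (big_cup D) x)) as [Lx|nLx].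
    + destruct (directed_union_dense sD neD dir
        (* The density statement is applied to the neighbourhood [O^-1 x] of [x]. *)
        (fun n => O (mul G x (inv G n))) Lx) as (N & n & DN & Nn & On).
      * exact (inv_cont G _ (open_mull x _ oO)).
      * now rewrite mulgV.
      * exists (fun y => O (mul G y (inv G n))).
        split; [exact (open_mulr (inv G n) _ oO)|]. split; [exact On|].
        exists N. eauto.
    + exists (fun y => ~ closed_gen (big_cup D) y).
      split; [apply closed_gen_closed_subgroup|]. split; [exact nLx|].
      destruct neD as [N0 DN0]. exists N0. split; [assumption|tauto].
Qed.

End Topology.

Theorem mainTheorem6 (G : TopGroup) :
  hausdorff G -> locally_compact G -> compactly_generated G ->
  (forall F : (G -> Prop) -> Prop,
     (forall N, F N -> closed_normal_subgroup N) ->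
     (exists N, F N) -> filtering F ->
     exists N K, F N /\ closed_normal_subgroup K /\
       subset (big_cap F) K /\ subset K N /\
       quotient_compact K (big_cap F) /\ quotient_discrete N K) /\
  (forall D : (G -> Prop) -> Prop,
     (forall N, D N -> closed_normal_subgroup N) ->
     (exists N, D N) -> directed D ->
     exists N K, D N /\ closed_normal_subgroup K /\
       subset N K /\ subset K (closed_gen (big_cup D)) /\
       quotient_compact K N /\
       quotient_discrete (closed_gen (big_cup D)) K).
Proof.
  intros _ lc (S & cS & genS).
  destruct (lc (one G)) as (W & C & oW & W1 & cC & WC).
  (* [O] is built for the open set [W] inside [C], so each containment in [W] gives one in [C]. It
     depends on no family and serves both parts. *)
  destruct (exists_small_neighbourhood _ cS oW W1)
    as (O & oO & O1 & OW & Oinv & Omul & Oconj).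
  assert (core : forall A B, closed_normal_subgroup A ->
    closed_normal_subgroup B -> subset B A ->
    (forall x, A x -> C x -> exists b, B b /\ O (mul G x (inv G b))) ->
    exists K, closed_normal_subgroup K /\ subset B K /\ subset K A /\
      quotient_compact K B /\ quotient_discrete A K).
  { intros A B cnA cnB BA small.
    apply (exists_relatively_compact_open_normal (S := S) (C := C) (O := O)); auto.
    - intros x Ox. auto.
    - intros s o Ss Oo. destruct (Oconj s o Ss Oo). auto. }
  split.
  - intros F cnF neF filt.
    destruct (filtering_small_member (F := F) (C := C) O)
      as (N & FN & HN); auto.
    { intros N FN. now apply cnF. }
    destruct (core N (big_cap F)) as (K & HK); auto.
    + now apply big_cap_closed_normal.
    + intros x Mx. exact (Mx N FN).
    + exists N, K. auto.
  - intros D cnD neD dir.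
    destruct (directed_large_member (D := D) (C := C) O)
      as (N & DN & HN); auto.
    { intros N DN. now apply cnD. }
    destruct (core (closed_gen (big_cup D)) N) as (K & HK); auto.
    + apply closed_gen_normal. intros g x (M & DM & Mx).
      exists M. split; [exact DM|]. now apply cnD.
    + intros x Nx H _ _ DH. apply DH. now exists N.
    + exists N, K. auto.
Qed.
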